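(* Let $\mathbb{K}$ be a field. A full subcategory $\mathcal{V}$ of $\mathsf{Alg}_{\mathbb{K}}$ is a variety of non-associative $\mathbb{K}$-algebras if and only if it is a Birkhoff subcategory of $\mathsf{Alg}_{\mathbb{K}}$.
   Context: Fix a field $\mathbb{K}$. A (non-associative) algebra over $\mathbb{K}$ is a $\mathbb{K}$-vector space $A$ with a bilinear multiplication $A\times A\to A$ (no associativity, unit, etc. is assumed). Morphisms are linear maps preserving the multiplication; the resulting category is $\mathsf{Alg}_{\mathbb{K}}$. Let $X=\{x_1,x_2,\dots\}$ be a countable set of variables and let $\mathbb{K}[M(X)]$ be the free non-associative $\mathbb{K}$-algebra on $X$ (the vector space with basis the free magma $M(X)$ on $X$, with bilinearly extended multiplication); its elements are called polynomials. A polynomial $\psi(x_1,\dots,x_n)$ is an identity of $A$ if $\psi(a_1,\dots,a_n)=0$ for all $a_1,\dots,a_n\in A$. A variety of non-associative $\mathbb{K}$-algebras is the full subcategory of $\mathsf{Alg}_{\mathbb{K}}$ consisting of all algebras satisfying every identity in some given subset of $\mathbb{K}[M(X)]$. A Birkhoff subcategory $\mathcal{D}$ of a semi-abelian category $\mathcal{C}$ (here $\mathcal{C}=\mathsf{Alg}_{\mathbb{K}}$) is a full subcategory which is reflective (the inclusion functor $\mathcal{D}\to\mathcal{C}$ has a left adjoint), closed under subobjects (if $m\colon M\to D$ is a monomorphism in $\mathcal{C}$ and $D$ is in $\mathcal{D}$, then $M$ is in $\mathcal{D}$) and closed under quotients (if $q\colon D\to Q$ is a regular epimorphism in $\mathcal{C}$,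 i.e. a coequaliser of some parallel pair, and $D$ is in $\mathcal{D}$, then $Q$ is in $\mathcal{D}$). *)

(* Defs.v *)
From HB Require Import structures.
From mathcomp Require Import all_boot all_algebra.
From mathcomp Require Import finmap.
From mathcomp Require Import boolp.
From mathcomp Require Import monalg.

Set Implicit Arguments.
Unset Strict Implicit.
Unset Printing Implicit Defensive.

Import GRing.Theory.
Local Open Scope ring_scope.

Record category := Category {
  obj :> Type;
  mor : obj -> obj -> Type;
  idm : forall A, mor A A;
  compose : forall A B C, mor B C -> mor A B -> mor A C;
  compose_idl : forall A B (f : mor A B), compose (idm B) f = f;
  compose_idr : forall A B (f : mor A B), compose f (idm A) = f;
  composeA : forall A B C D (h : mor C D) (g : mor B C) (f : mor A B),
    compose h (compose g f) = compose (compose h g) f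
}.

Arguments mor {_} _ _.
Arguments idm {_} _.
Arguments compose {_ _ _ _} _ _.

Record functor (C D : category) := Functor {
  fobj :> C -> D;
  fmor : forall A B : C, mor A B -> mor (fobj A) (fobj B);
  fmor_id : forall A : C, fmor (idm A) = idm (fobj A);
  fmor_compose : forall (A B E : C) (g : mor B E) (f : mor A B),
    fmor (compose g f) = compose (fmor g) (fmor f)
}.

Arguments fmor {_ _} _ {_ _} _.

Definition left_adjoint (C D : category) (L : functor C D) (R : functor D C) :=
  exists phi : forall (A : C) (B : D), mor (L A) B -> mor A (R B),
    (forall A B, bijective (@phi A B)) /\
    (forall (A A' : C) (B B' : D)
            (f : mor A' A) (g : mor B B') (h : mor (L A) B),
       phi A' B' (compose g (compose h (fmor L f)))
       = compose (fmor R g) (compose (phi A B h) f)).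

Section CategoryTheory.
Variable C : category.

Definition monomorphism (A B : C) (m : mor A B) : Prop :=
  forall (Z : C) (f g : mor Z A), compose m f = compose m g -> f = g.

Definition is_coequaliser (A B Q : C) (f g : mor A B) (q : mor B Q) : Prop :=
  compose q f = compose q g /\
  forall (Z : C) (h : mor B Z), compose h f = compose h g ->
    exists! k : mor Q Z, compose k q = h.

Definition regular_epimorphism (B Q : C) (q : mor B Q) : Prop :=
  exists (A : C) (f g : mor A B), is_coequaliser f g q.

(* A full subcategory is determined by its class of objects [P]. *)
Variable P : C -> Prop.

Definition full_subcategory : category := {|
  obj := {A : C | P A};
  mor := fun A B => mor (sval A) (sval B);
  idm := fun A => idm (sval A);
  compose := fun A B E g f => compose g f;
  compose_idl := fun A B f => compose_idl f;
  compose_idr := fun A B f => compose_idr f;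
  composeA := fun A B E F h g f => composeA h g f
|}.

Definition inclusion : functor full_subcategory C :=
  @Functor full_subcategory C (fun A => sval A) (fun A B f => f)
    (fun A => erefl) (fun A B E g f => erefl).

Definition reflective : Prop :=
  exists L : functor C full_subcategory, left_adjoint L inclusion.

Definition closed_under_subobjects : Prop :=
  forall (M D : C) (m : mor M D), monomorphism m -> P D -> P M.

Definition closed_under_quotients : Prop :=
  forall (D Q : C) (q : mor D Q), regular_epimorphism q -> P D -> P Q.

Definition birkhoff_subcategory : Prop :=
  [/\ reflective, closed_under_subobjects & closed_under_quotients].

End CategoryTheory.

Record nalgebra (K : fieldType) := NAlgebra {
  nalg_vect :> lmodType K;
  nalg_mul : {bilinear nalg_vect -> nalg_vect -> nalg_vect}
}.

Arguments nalg_mul {K _}.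

Record alg_hom (K : fieldType) (A B : nalgebra K) := AlgHom {
  alg_fun :> {linear A -> B};
  alg_homM : {morph alg_fun : x y / nalg_mul x y}
}.

Lemma alg_hom_eq (K : fieldType) (A B : nalgebra K) (f g : alg_hom A B) :
  f =1 g -> f = g.
Proof.
case: f g => [[f [[f1] [f2]]] fM] [[g [[g1] [g2]]] gM] /= /funext fg.
have {}fg : f = g by exact: fg.
subst g; rewrite (Prop_irrelevance g1 f1) (Prop_irrelevance g2 f2) in gM *.
by rewrite (Prop_irrelevance gM fM).
Qed.

Section AlgCategory.
Variable K : fieldType.

Definition alg_id (A : nalgebra K) : alg_hom A A :=
  @AlgHom K A A (idfun : {linear A -> A}) (fun x y => erefl).

Lemma alg_comp_homM (A B C : nalgebra K) (g : alg_hom B C) (f : alg_hom A B) :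
  {morph (g \o f) : x y / nalg_mul x y}.
Proof. by move=> x y /=; rewrite !alg_homM. Qed.

Definition alg_comp (A B C : nalgebra K) (g : alg_hom B C) (f : alg_hom A B) :
  alg_hom A C := @AlgHom K A C (g \o f : {linear A -> C}) (alg_comp_homM g f).

Definition Alg : category.
Proof.
refine (@Category (nalgebra K) (@alg_hom K) alg_id alg_comp _ _ _);
  by move=> *; apply: alg_hom_eq.
Defined.

End AlgCategory.

Inductive free_magma (X : Type) : Type :=
| MVar of X
| MMul of free_magma X & free_magma X.

Arguments MVar {X}.

Section FreeMagmaChoice.
Variable X : Type.

Fixpoint tree_of_magma (u : free_magma X) : GenTree.tree X :=
  match u with
  | MVar x => GenTree.Leaf x
  | MMul v w => GenTree.Node 0 [:: tree_of_magma v; tree_of_magma w]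
  end.

Fixpoint magma_of_tree (t : GenTree.tree X) : option (free_magma X) :=
  match t with
  | GenTree.Leaf x => Some (MVar x)
  | GenTree.Node _ [:: t1; t2] =>
      match magma_of_tree t1, magma_of_tree t2 with
      | Some v, Some w => Some (MMul v w)
      | _, _ => None
      end
  | _ => None
  end.

Lemma tree_of_magmaK : pcancel tree_of_magma magma_of_tree.
Proof. by elim=> //= v -> w ->. Qed.

End FreeMagmaChoice.

HB.instance Definition _ (X : eqType) :=
  Equality.copy (free_magma X) (pcan_type (@tree_of_magmaK X)).
HB.instance Definition _ (X : choiceType) :=
  Choice.copy (free_magma X) (pcan_type (@tree_of_magmaK X)).

Section LinearExtension.
Variables (K : fieldType) (M : choiceType) (V : lmodType K).

Definition linext (f : M -> V) (p : {malg K[M]}) : V :=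
  \sum_(u <- msupp p) p@_u *: f u.

Lemma linextEw (f : M -> V) (p : {malg K[M]}) (d : {fset M}) :
  (msupp p `<=` d)%fset -> linext f p = \sum_(u <- d) p@_u *: f u.
Proof.
move=> sub; rewrite /linext (big_fset_incl _ sub) // => u _ /mcoeff_outdom ->.
by rewrite scale0r.
Qed.

Lemma linext_is_linear (f : M -> V) : linear (linext f).
Proof.
move=> c p q; pose d := (msupp p `|` msupp q `|` msupp (c *: p + q))%fset.
rewrite !(@linextEw f _ d) ?fsubsetUr //; first last.
- by rewrite /d -fsetUA fsubsetUl.
- by rewrite /d fsetUAC fsubsetUr.
rewrite scaler_sumr -big_split /=; apply: eq_bigr => u _.
by rewrite mcoeffD mcoeffZ scalerDl scalerA.
Qed.

HB.instance Definition _ (f : M -> V) :=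
  GRing.isLinear.Build K {malg K[M]} V *:%R (linext f) (linext_is_linear f).

Lemma linextU (f : M -> V) (u : M) : linext f << u >> = f u.
Proof.
by rewrite (linextEw f msuppU_le) big_seq_fset1 mcoeffUU scale1r.
Qed.

Lemma linext_funP (f g : M -> V) (c : K) (p : {malg K[M]}) :
  linext (fun u => c *: f u + g u) p = c *: linext f p + linext g p.
Proof.
rewrite /linext scaler_sumr -big_split; apply: eq_bigr => u _ /=.
by rewrite scalerDr !scalerA mulrC.
Qed.

Lemma linext_unique (h : {linear {malg K[M]} -> V}) :
  h =1 linext (fun u => h << u >>).
Proof.
move=> p; rewrite {1}[p]monalgE linear_sum; apply: eq_bigr => u _.
rewrite -linearZ; congr (h _); apply/malgP => v.
by rewrite mcoeffZ !mcoeffU mulrnAr mulr1.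
Qed.

End LinearExtension.

Section FreeAlgebra.
Variables (K : fieldType) (X : choiceType).

Definition pmul (p q : {malg K[free_magma X]}) : {malg K[free_magma X]} :=
  linext (fun u => linext (fun v => << MMul u v >>) q) p.

Lemma pmul_is_bilinear : bilinear_for *:%R *:%R pmul.
Proof.
split=> [q|p] c r s /=; rewrite /pmul; first by rewrite linearP.
by rewrite -linext_funP; congr linext; apply/funext => u; rewrite linearP.
Qed.

HB.instance Definition _ := bilinear_isBilinear.Build K
  {malg K[free_magma X]} {malg K[free_magma X]} {malg K[free_magma X]}
  *:%R *:%R pmul pmul_is_bilinear.

Definition free_alg : nalgebra K :=
  @NAlgebra K {malg K[free_magma X]} pmul.

End FreeAlgebra.

Section Evaluation.
Variables (K : fieldType) (X : choiceType) (A : nalgebra K) (a : X -> A).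

Fixpoint monom_eval (u : free_magma X) : A :=
  match u with
  | MVar x => a x
  | MMul v w => nalg_mul (monom_eval v) (monom_eval w)
  end.

Lemma linext_monom_evalM (p q : free_alg K X) :
  linext monom_eval (nalg_mul p q)
  = nalg_mul (linext monom_eval p) (linext monom_eval q).
Proof.
rewrite [linext _ p]/linext linear_sumlz linear_sum /=.
apply: eq_bigr => u _; rewrite linearZ linearZl_LR /=; congr (_ *: _).
rewrite [linext _ q in RHS]/linext linear_sumr linear_sum /=.
by apply: eq_bigr => v _; rewrite linearZ linearZr_LR /= linextU.
Qed.

Definition peval : alg_hom (free_alg K X) A :=
  @AlgHom K (free_alg K X) A (linext monom_eval) linext_monom_evalM.

End Evaluation.

Section Varieties.
Variable K : fieldType.

Definition na_poly := free_alg K nat.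

(* Assigning a value to every variable is harmless: only the finitely many
   variables occurring in [psi] matter. *)
Definition is_identity (A : nalgebra K) (psi : na_poly) : Prop :=
  forall a : nat -> A, peval a psi = 0.

Definition is_variety (V : nalgebra K -> Prop) : Prop :=
  exists I : na_poly -> Prop,
    forall A : nalgebra K, V A <-> (forall psi, I psi -> is_identity A psi).

End Varieties.

(* Main.v *)
(** The reflection of [A] into a variety is the quotient of [A] by the ideal of
    elements killed by every homomorphism into the variety. Conversely, let [V]
    be Birkhoff and let [A] satisfy all identities common to [V]. If [eta] is the
    unit of the reflection at the free algebra [F] on the set [A], every
    homomorphism from [F] to an object of [V] factors through [eta], so an
    element of [ker eta] is, up to renaming its finitely many variables, an
    identity of [V], hence vanishes in [A]. Thus [A] is a quotient of
    [F / ker eta], which embeds in the reflection of [F] and so lies in [V]. *)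

Require Import Defs.
From HB Require Import structures.
From mathcomp Require Import all_boot all_algebra.
From mathcomp Require Import finmap.
From mathcomp Require Import boolp.
From mathcomp Require Import monalg.

Set Implicit Arguments.
Unset Strict Implicit.
Unset Printing Implicit Defensive.

Import GRing.Theory.
Local Open Scope ring_scope.
Local Open Scope quotient_scope.

(** * Ideals and quotient algebras *)

Record ideal (K : fieldType) (A : nalgebra K) := Ideal {
  ideal_pred :> pred A;
  ideal_submod : submod_closed ideal_pred;
  ideal_mull : forall x y, y \in ideal_pred -> nalg_mul x y \in ideal_pred;
  ideal_mulr : forall x y, x \in ideal_pred -> nalg_mul x y \in ideal_pred
}.

Section QuotientAlgebra.
Variables (K : fieldType) (A : nalgebra K).

HB.instance Definition _ (I : ideal A) :=
  GRing.isZmodClosed.Build A (ideal_pred I) (GRing.submod_closedB (ideal_submod I)).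

Variable I : ideal A.

Definition ideal_zmod : zmodClosed A := GRing.ZmodClosed.clone A (ideal_pred I) _.
Let T := Quotient.quot ideal_zmod.

Definition quot_alg_type : Type := T.
HB.instance Definition _ := GRing.Zmodule.on quot_alg_type.

Definition quot_pi (x : A) : quot_alg_type := \pi_T x.

Lemma quot_pi_surj (q : quot_alg_type) : quot_pi (repr (q : T)) = q.
Proof. exact: reprK. Qed.

Lemma quot_pi_eq x y : quot_pi x = quot_pi y <-> x - y \in ideal_pred I.
Proof. by rewrite Quotient.idealrBE; split=> [/eqP|/eqP]. Qed.

Lemma quot_piD : {morph quot_pi : x y / x + y}.
Proof. by move=> x y; rewrite /quot_pi !piE. Qed.

(** The scalar acts on a chosen representative; [quot_piZ] makes the choice immaterial, and the
    module laws then descend from [A]. *)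
Definition quot_scale (c : K) (q : quot_alg_type) : quot_alg_type :=
  quot_pi (c *: repr (q : T)).

Lemma quot_piZ c x : quot_pi (c *: x) = quot_scale c (quot_pi x).
Proof.
apply/quot_pi_eq; rewrite -scalerBr.
have [I0 Ilin] := ideal_submod I.
rewrite -[_ *: _]addr0; apply: Ilin => //.
by apply/quot_pi_eq; rewrite quot_pi_surj.
Qed.

Lemma quot_scaleA a b q :
  quot_scale a (quot_scale b q) = quot_scale (a * b) q.
Proof. by rewrite -[q]quot_pi_surj -!quot_piZ scalerA. Qed.

Lemma quot_scale1 : left_id 1 quot_scale.
Proof. by move=> q; rewrite -[q]quot_pi_surj -quot_piZ scale1r. Qed.

Lemma quot_scaleDr : right_distributive quot_scale +%R.
Proof.
move=> c q r; rewrite -[q]quot_pi_surj -[r]quot_pi_surj.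
by rewrite -quot_piD -!quot_piZ -quot_piD scalerDr.
Qed.

Lemma quot_scaleDl q : {morph quot_scale^~ q : a b / a + b}.
Proof.
move=> a b; rewrite -[q]quot_pi_surj.
by rewrite -!quot_piZ -quot_piD scalerDl.
Qed.

HB.instance Definition _ := GRing.Zmodule_isLmodule.Build K quot_alg_type
  quot_scaleA quot_scale1 quot_scaleDr quot_scaleDl.

Lemma quot_pi_is_linear : linear quot_pi.
Proof. by move=> c x y; rewrite quot_piD quot_piZ. Qed.

HB.instance Definition _ :=
  GRing.isLinear.Build K A quot_alg_type *:%R quot_pi quot_pi_is_linear.

Definition quot_mul (q r : quot_alg_type) : quot_alg_type :=
  quot_pi (nalg_mul (repr (q : T)) (repr (r : T))).

Lemma quot_piM x y : quot_pi (nalg_mul x y) = quot_mul (quot_pi x) (quot_pi y).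
Proof.
pose x' := repr (quot_pi x : T); pose y' := repr (quot_pi y : T).
(* One factor changes at a time: [(x - x') y] lies in the ideal by [ideal_mulr], then [x' (y - y')]
   by [ideal_mull]. *)
transitivity (quot_pi (nalg_mul x' y)); apply/quot_pi_eq.
  rewrite -linearBl; apply: ideal_mulr.
  by apply/quot_pi_eq; rewrite quot_pi_surj.
rewrite -linearBr; apply: ideal_mull.
by apply/quot_pi_eq; rewrite quot_pi_surj.
Qed.

Lemma quot_mul_is_bilinear : bilinear_for *:%R *:%R quot_mul.
Proof.
split=> [q|q] c r s /=.
  rewrite -[q]quot_pi_surj -[r]quot_pi_surj -[s]quot_pi_surj.
  by rewrite -linearP -!quot_piM linearPl linearP.
rewrite -[q]quot_pi_surj -[r]quot_pi_surj -[s]quot_pi_surj.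
by rewrite -linearP -!quot_piM linearPr linearP.
Qed.

HB.instance Definition _ := bilinear_isBilinear.Build K
  quot_alg_type quot_alg_type quot_alg_type
  *:%R *:%R quot_mul quot_mul_is_bilinear.

Definition quot_alg : nalgebra K := @NAlgebra K quot_alg_type quot_mul.

Definition quot_proj : alg_hom A quot_alg :=
  @AlgHom K A quot_alg quot_pi quot_piM.

Lemma quot_proj_surj (q : quot_alg) : exists x, quot_proj x = q.
Proof. by exists (repr (q : T)); apply: quot_pi_surj. Qed.

Lemma quot_proj_eq x y : quot_proj x = quot_proj y <-> x - y \in ideal_pred I.
Proof. exact: quot_pi_eq. Qed.

(** * Homomorphisms out of a quotient algebra *)

Section Factor.
Variables (B : nalgebra K) (f : alg_hom A B).
Hypothesis fI : forall x, x \in ideal_pred I -> f x = 0.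

Definition factor_fun (q : quot_alg) : B := f (repr (q : T)).

Lemma factor_fun_proj x : factor_fun (quot_proj x) = f x.
Proof.
apply/eqP; rewrite -subr_eq0 -linearB; apply/eqP/fI.
by apply/quot_proj_eq; apply: quot_pi_surj.
Qed.

Lemma factor_fun_is_linear : linear factor_fun.
Proof.
move=> c q r; have [x <-] := quot_proj_surj q; have [y <-] := quot_proj_surj r.
by rewrite -linearP !factor_fun_proj linearP.
Qed.

HB.instance Definition _ :=
  GRing.isLinear.Build K quot_alg B *:%R factor_fun factor_fun_is_linear.

Lemma factor_funM : {morph factor_fun : x y / nalg_mul x y}.
Proof.
move=> q r; have [x <-] := quot_proj_surj q; have [y <-] := quot_proj_surj r.
by rewrite -alg_homM !factor_fun_proj alg_homM.
Qed.

Definition factor : alg_hom quot_alg B :=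
  @AlgHom K quot_alg B factor_fun factor_funM.

Lemma factor_proj x : factor (quot_proj x) = f x.
Proof. exact: factor_fun_proj. Qed.

End Factor.

End QuotientAlgebra.

Lemma alg_hom_app (K : fieldType) (A B : nalgebra K) (f g : alg_hom A B) :
  f = g -> f =1 g.
Proof. by move=> ->. Qed.

(** * Ideals as intersections of kernels *)

Section HomIdeals.
Variables (K : fieldType) (A : nalgebra K).

Variable F : forall B : nalgebra K, alg_hom A B -> Prop.

(** Targets vary with the homomorphism, so one construction serves both the kernel of a single map
    and the ideal defining the reflection. *)
Definition common_kernel : pred A :=
  fun x => `[< forall B (f : alg_hom A B), F f -> f x = 0 >].

Lemma common_kernelP x :
  x \in common_kernel <-> forall B (f : alg_hom A B), F f -> f x = 0.
Proof. by split=> [/asboolP|?]; last exact/asboolP. Qed.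

Lemma common_kernel_submod : submod_closed common_kernel.
Proof.
split=> [|c x y /common_kernelP kx /common_kernelP ky]; apply/common_kernelP.
  by move=> B f _; rewrite linear0.
by move=> B f Ff; rewrite linearP kx ?ky // scaler0 addr0.
Qed.

Lemma common_kernel_mull x y :
  y \in common_kernel -> nalg_mul x y \in common_kernel.
Proof.
move=> /common_kernelP ky; apply/common_kernelP => B f Ff.
by rewrite alg_homM ky // linear0r.
Qed.

Lemma common_kernel_mulr x y :
  x \in common_kernel -> nalg_mul x y \in common_kernel.
Proof.
move=> /common_kernelP kx; apply/common_kernelP => B f Ff.
by rewrite alg_homM kx // linear0l.
Qed.

Definition common_kernel_ideal : ideal A :=
  Ideal common_kernel_submod common_kernel_mull common_kernel_mulr.

End HomIdeals.

Section Kernel.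
Variables (K : fieldType) (A B : nalgebra K) (f : alg_hom A B).

(** The maps vanishing wherever [f] does include [f] itself, so their common kernel is exactly the
    kernel of [f], and the ideal laws are inherited. *)
Definition kernel : ideal A :=
  common_kernel_ideal (fun C (g : alg_hom A C) => forall x, f x = 0 -> g x = 0).

Lemma kernelP x : x \in ideal_pred kernel <-> f x = 0.
Proof.
split=> [/common_kernelP /(_ B f)|fx0]; first by apply.
by apply/common_kernelP => C g; apply.
Qed.

End Kernel.

(** * Evaluation and renaming of variables *)

Section PolynomialEvaluation.
Variable K : fieldType.

Lemma peval_var (X : choiceType) (A : nalgebra K) (a : X -> A) x :
  peval a << MVar x >> = a x.
Proof. exact: linextU. Qed.

Lemma peval_hom (X : choiceType) (A B : nalgebra K) (f : alg_hom A B)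
    (a : X -> A) p :
  f (peval a p) = peval (f \o a) p.
Proof.
rewrite /= /linext linear_sum; apply: eq_bigr => u _; rewrite linearZ /=.
by congr (_ *: _); elim: u => //= v IHv w IHw; rewrite alg_homM IHv IHw.
Qed.

Fixpoint magma_vars (X : Type) (u : free_magma X) : seq X :=
  match u with
  | MVar x => [:: x]
  | MMul v w => magma_vars v ++ magma_vars w
  end.

Definition poly_vars (X : choiceType) (p : free_alg K X) : seq X :=
  flatten [seq magma_vars u | u <- msupp p].

Lemma eq_in_peval (X : choiceType) (A : nalgebra K) (a b : X -> A)
    (p : free_alg K X) :
  {in poly_vars p, a =1 b} -> peval a p = peval b p.
Proof.
move=> eq_ab; rewrite /= /linext; apply: eq_big_seq => u u_p; congr (_ *: _).
have {eq_ab} : {in magma_vars u, a =1 b}.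
  by move=> x x_u; apply: eq_ab; apply/flatten_mapP; exists u.
elim: u {u_p} => [x|v IHv w IHw] /= eq_ab; first by apply: eq_ab; rewrite inE.
by rewrite IHv ?IHw // => x xv; apply: eq_ab; rewrite mem_cat xv ?orbT.
Qed.

(** Renaming each variable to its position in [poly_vars p] gives a polynomial over [nat] that takes
    the same values as [p] in every algebra. *)
Lemma number_variables (X : choiceType) (p : free_alg K X) :
  exists (psi : na_poly K) (s : X -> nat),
    (forall (A : nalgebra K) (a : X -> A),
        exists b : nat -> A, peval b psi = peval a p)
    /\ (forall (A : nalgebra K) (b : nat -> A), peval b psi = peval (b \o s) p).
Proof.
pose s x := index x (poly_vars p).
pose psi : na_poly K := peval (A := free_alg K nat) (fun x => << MVar (s x) >>) p.
have psiE (A : nalgebra K) (b : nat -> A) : peval b psi = peval (b \o s) p.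
  rewrite /psi peval_hom; apply: eq_in_peval => x _; exact: peval_var.
exists psi, s; split=> // A a.
(* Only positions of variables occurring in [p] are read, so the default 0 never matters. *)
exists (fun n => nth 0 [seq a x | x <- poly_vars p] n).
rewrite psiE; apply: eq_in_peval => x xp /=.
by rewrite (nth_map x) ?index_mem // nth_index.
Qed.

End PolynomialEvaluation.

(** * Monomorphisms and regular epimorphisms of algebras *)

Section AlgMorphisms.
Variable K : fieldType.

(** Elements of [A] are homomorphisms from the free algebra on one generator, and these can be
    cancelled against [m]. *)
Lemma mono_injective (A B : Alg K) (m : mor A B) :
  monomorphism m -> injective (alg_fun m).
Proof.
move=> m_mono x y mxy.
pose c z : alg_hom (free_alg K unit) A := peval (fun=> z).
suff /alg_hom_app/(_ << MVar tt >>) : c x = c y.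
  by rewrite !peval_var.
apply: m_mono; apply: alg_hom_eq => p.
rewrite /= -!/(alg_fun (peval _) p).
rewrite !(peval_hom m); congr (alg_fun (peval _) p).
by apply/funext => -[].
Qed.

Lemma injective_mono (A B : Alg K) (m : mor A B) :
  injective (alg_fun m) -> monomorphism m.
Proof.
move=> m_inj Z f g mfg; apply: alg_hom_eq => z; apply: m_inj.
exact: alg_hom_app mfg z.
Qed.

(** The projection onto [B / ker q] also identifies [f] and [g], so it factors through [q] by some
    [k]; this [k] is a section of the induced map [r]. *)
Lemma regular_epi_surjective (B Q : Alg K) (q : mor B Q) :
  regular_epimorphism q -> forall y : Q, exists x : B, alg_fun q x = y.
Proof.
move=> [A [f [g [qfg qU]]]].
have kq x : x \in ideal_pred (kernel q) -> alg_fun q x = 0 by move/kernelP.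
pose pi : @mor (Alg K) B (quot_alg (kernel q)) := quot_proj (kernel q).
pose r : @mor (Alg K) (quot_alg (kernel q)) Q := factor kq.
have rpi : compose r pi = q by apply: alg_hom_eq => x; apply: factor_proj.
have /qU[k [kqE _]] : compose pi f = compose pi g.
  apply: alg_hom_eq => x; apply/quot_proj_eq/kernelP; rewrite linearB.
  by apply/eqP; rewrite subr_eq0; apply/eqP; exact: alg_hom_app qfg x.
(* Both the identity and [compose r k] fix [q] under composition, so uniqueness equates them. *)
have [h [_ hU]] := qU Q q qfg.
have rk : compose r k = idm Q.
  transitivity h; first symmetry; apply: hU; last exact: compose_idl.
  by rewrite -composeA kqE.
move=> y; have [x xE] := quot_proj_surj (alg_fun k y); exists x.
rewrite -[LHS](factor_proj kq) xE.
exact: alg_hom_app rk y.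
Qed.

(* The parallel pair is defined on the free algebra over the set of pairs
   identified by [q], which spares the construction of the kernel pair. *)
Lemma surjective_regular_epi (B Q : Alg K) (q : mor B Q) :
  (forall y : Q, exists x : B, alg_fun q x = y) -> regular_epimorphism q.
Proof.
move=> q_surj.
pose X : choiceType := {xy : B * B | alg_fun q xy.1 == alg_fun q xy.2}.
exists (free_alg K X), (peval (fun u : X => (val u).1)),
  (peval (fun u : X => (val u).2)); split.
  apply: alg_hom_eq => p; rewrite /= -!/(alg_fun (peval _) p).
  rewrite !(peval_hom q); congr (alg_fun (peval _) p).
  by apply/funext => -[u /= /eqP].
move=> Z h hE.
(* The pair [(x, y)] is itself a generator of the free algebra, where the equation [hE] can be read
   off. *)
have h_ker x y : alg_fun q x = alg_fun q y -> alg_fun h x = alg_fun h y.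
  move=> /eqP qxy; pose u : X := exist _ (x, y) qxy.
  have := alg_hom_app hE << MVar u >>.
  by rewrite /= !linextU.
(* [t] is only a set-theoretic section of [q]; [h \o t] is a homomorphism because [h] is constant on
   the fibres of [q]. *)
pose t y : B := sval (cid (q_surj y)).
have tK y : alg_fun q (t y) = y by rewrite /t; case: cid.
pose k y : Z := alg_fun h (t y).
have k_lin : linear k.
  by move=> c x y; rewrite /k -linearP; apply: h_ker; rewrite linearP !tK.
have k_mul : {morph k : x y / nalg_mul x y}.
  by move=> x y; rewrite /k -alg_homM; apply: h_ker; rewrite alg_homM !tK.
pose kL : {linear (Q : nalgebra K) -> (Z : nalgebra K)} :=
  HB.pack k (GRing.isLinear.Build K Q Z *:%R k k_lin).
pose kH : @mor (Alg K) Q Z := @AlgHom K Q Z kL k_mul.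
exists kH; split.
  by apply: alg_hom_eq => x; apply: h_ker; apply: tK.
move=> k' k'E; apply: alg_hom_eq => y; rewrite -{2}[y]tK.
exact: esym (alg_hom_app k'E (t y)).
Qed.

End AlgMorphisms.

(** * Varieties are Birkhoff subcategories *)

Section VarietyBirkhoff.
Variables (K : fieldType) (V : nalgebra K -> Prop).

Lemma variety_subobjects : is_variety V -> closed_under_subobjects (C := Alg K) V.
Proof.
move=> [I VI] M D m /mono_injective m_inj /VI D_I; apply/VI => psi /D_I psi0 a.
by apply: m_inj; rewrite peval_hom psi0 linear0.
Qed.

Lemma variety_quotients : is_variety V -> closed_under_quotients (C := Alg K) V.
Proof.
move=> [I VI] D Q q /regular_epi_surjective/choice[t tK] /VI D_I.
apply/VI => psi /D_I psi0 a.
rewrite (_ : a = alg_fun q \o (t \o a)); last by apply/funext => n /=; rewrite tK.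
by rewrite -peval_hom psi0 linear0.
Qed.

Definition refl_ideal (A : nalgebra K) : ideal A :=
  common_kernel_ideal (fun B (_ : alg_hom A B) => V B).

Lemma refl_ideal_hom (A B : nalgebra K) (f : alg_hom A B) :
  V B -> forall x, x \in ideal_pred (refl_ideal A) -> f x = 0.
Proof. by move=> VB x /common_kernelP; apply. Qed.

(** Lift the assignment to [A]: a homomorphism into [V] sends the value of [psi] to a value of [psi]
    there, which is zero, so that value already lies in the ideal. *)
Lemma variety_refl (A : nalgebra K) : is_variety V -> V (quot_alg (refl_ideal A)).
Proof.
move=> [I VI]; apply/VI => psi Ipsi a.
have /choice[t tK] := @quot_proj_surj K A (refl_ideal A).
rewrite (_ : a = quot_proj (refl_ideal A) \o (t \o a)); last first.
  by apply/funext => n; apply/esym/tK.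
rewrite -peval_hom -(linear0 (quot_proj (refl_ideal A))).
apply/quot_proj_eq; rewrite subr0; apply/common_kernelP => B f /VI B_I.
by rewrite peval_hom B_I.
Qed.

Lemma variety_reflective : is_variety V -> reflective (C := Alg K) V.
Proof.
move=> V_var.
pose D := full_subcategory (C := Alg K) V.
pose L0 (A : Alg K) : D := exist _ (quot_alg (refl_ideal A)) (variety_refl A V_var).
pose pi (A : Alg K) : @mor (Alg K) A (sval (L0 A)) := quot_proj (refl_ideal A).
pose ext (A : Alg K) (B : D) (f : @mor (Alg K) A (sval B)) : mor (L0 A) B :=
  factor (refl_ideal_hom f (svalP B)).
have extK (A : Alg K) (B : D) (f : @mor (Alg K) A (sval B)) :
    compose (ext A B f : @mor (Alg K) _ _) (pi A) = f.
  by apply: alg_hom_eq => x; exact: (factor_proj (refl_ideal_hom f (svalP B))).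
(* Surjectivity of [pi] makes extensions unique; the functor laws and the bijection below reduce to
   this and [extK]. *)
have pi_epi (A B : Alg K) (f g : @mor (Alg K) (sval (L0 A)) B) :
    compose f (pi A) = compose g (pi A) -> f = g.
  move=> fg; apply: alg_hom_eq => y.
  have [x <-] := quot_proj_surj y.
  exact: alg_hom_app fg x.
pose L1 (A B : Alg K) (f : mor A B) : mor (L0 A) (L0 B) :=
  ext A (L0 B) (compose (pi B) f).
have L_id (A : Alg K) : L1 A A (idm A) = idm (L0 A).
  by apply: pi_epi; rewrite extK; apply: alg_hom_eq.
have L_comp (A B E : Alg K) (g : mor B E) (f : mor A B) :
    L1 A E (compose g f) = compose (L1 B E g) (L1 A B f).
  apply: pi_epi; rewrite extK -[in RHS](@composeA (Alg K)) extK.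
  by rewrite !(@composeA (Alg K)) extK.
exists (@Functor (Alg K) D L0 L1 L_id L_comp).
(* The adjunction is precomposition with the unit [pi], with inverse [ext]. *)
exists (fun (A : Alg K) (B : D) (h : mor (L0 A) B) =>
  compose (h : @mor (Alg K) _ _) (pi A)).
split=> [A B|A A' B B' f g h].
  exists (ext A B) => f; last exact: extK.
  by apply: pi_epi; rewrite extK.
change (compose (compose (g : @mor (Alg K) _ _)
  (compose (h : @mor (Alg K) _ _) (L1 A' A f))) (pi A')
  = compose (g : @mor (Alg K) _ _) (compose
      (compose (h : @mor (Alg K) _ _) (pi A)) f)).
by rewrite -!(@composeA (Alg K)) extK.
Qed.

Lemma variety_birkhoff : is_variety V -> birkhoff_subcategory (C := Alg K) V.
Proof.
move=> V_var; split.
- exact: variety_reflective.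
- exact: variety_subobjects.
- exact: variety_quotients.
Qed.

(** * Birkhoff subcategories are varieties *)

Lemma reflective_unit : reflective (C := Alg K) V ->
  forall A : nalgebra K, exists (R : nalgebra K) (eta : alg_hom A R), V R /\
    forall (B : nalgebra K) (f : alg_hom A B), V B ->
      exists h : alg_hom R B, forall x, f x = h (eta x).
Proof.
move=> [L [phi [phi_bij phi_nat]]] A.
exists (sval (L A)), (phi A (L A) (idm (L A))).
split=> [|B f VB]; first exact: svalP.
pose B' : full_subcategory (C := Alg K) V := exist _ B VB.
have [psi _ psiK] := phi_bij A B'.
exists (psi f) => x.
(* Naturality of [phi] at [psi f], applied to the identity of [L A], writes [f] as [psi f] after the
   unit. *)
have := phi_nat A A (L A) B' (idm (A : Alg K)) (psi f) (idm (L A)).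
rewrite fmor_id !compose_idl !compose_idr psiK => E.
exact: alg_hom_app E x.
Qed.

Lemma birkhoff_variety : birkhoff_subcategory (C := Alg K) V -> is_variety V.
Proof.
move=> [V_refl V_sub V_quot].
exists (fun psi => forall B : nalgebra K, V B -> is_identity B psi) => A.
split=> [VA psi|A_id]; first exact.
have [R [eta [VR etaU]]] := reflective_unit V_refl (free_alg K A).
have kerE x : x \in ideal_pred (kernel eta) -> peval (fun a : A => a) x = 0.
  move=> /kernelP eta_x.
  have [psi [s [psi_lift psiE]]] := number_variables x.
  (* It remains to see that [psi] holds throughout [V]: its value at [c] is that of [x] at [c \o s],
     an evaluation factoring through [eta]. *)
  have [b <-] := psi_lift A id; apply: A_id => B VB c; rewrite psiE.
  by have [h ->] := etaU B (peval (c \o s)) VB; rewrite eta_x linear0.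
have eta_ker x : x \in ideal_pred (kernel eta) -> eta x = 0 by move/kernelP.
have VFe : V (quot_alg (kernel eta)).
  apply: (V_sub _ R (factor eta_ker)) => //; apply: injective_mono => p q.
  have [x <-] := quot_proj_surj p; have [y <-] := quot_proj_surj q.
  rewrite !factor_proj => etaxy; apply/quot_proj_eq/kernelP.
  by rewrite linearB /= etaxy subrr.
(* The generator indexed by [y] evaluates to [y], so the induced map onto [A] is surjective. *)
apply: (V_quot _ A (factor kerE)) VFe; apply: surjective_regular_epi => y.
by exists (quot_proj (kernel eta) << MVar y >>); rewrite factor_proj peval_var.
Qed.

End VarietyBirkhoff.

Theorem theorem11p4 (K : fieldType) (V : nalgebra K -> Prop) :
  is_variety V <-> birkhoff_subcategory (C := Alg K) V.
Proof. by split; [apply: variety_birkhoff|apply: birkhoff_variety]. Qed.
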